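(* Let $\tau$ be the Takagi function and $\Omega^L$ the deficient digit set. The function $\tau^S$ defined on $\Omega^L$ by $\tau^S(x)=\tau(x)+x$ for $x\in\Omega^L$ is a nondecreasing function on $\Omega^L$. Define its extension to all $x\in[0,1]$ by $$\tau^S(x)=\sup\{\tau^S(x_1): x_1\le x,\ x_1\in\Omega^L\}.$$ Then $\tau^S$ is a monotone singular function; that is, it is a nondecreasing continuous function on $[0,1]$ with $\tau^S(0)=0$ and $\tau^S(1)=1$, which has derivative zero at Lebesgue almost all points of $[0,1]$. The closure of the set of points of increase of $\tau^S$ is the deficient digit set $\Omega^L$.
   Context: The Takagi function is $\tau(x)=\sum_{n=0}^\infty 2^{-n}\operatorname{dist}(2^n x,\mathbb{Z})$ for $x\in[0,1]$, where $\operatorname{dist}(t,\mathbb{Z})=\inf_{m\in\mathbb{Z}}|t-m|$. For a binary expansion $x=0.b_1b_2\ldots=\sum_{j\ge1}b_j2^{-j}$, $b_j\in\{0,1\}$, put $D_j(x)=j-2(b_1+\cdots+b_j)$ for $j\ge1$. The deficient digit set $\Omega^L$ is the set of all $x\in[0,1]$ having a binary expansion with $D_j(x)\ge0$ for all $j\ge1$ (at most one of the two expansions of a dyadic rational can have this property; if one does, the dyadic rational belongs to $\Omega^L$). A point $x\in(0,1)$ is a point of increase of a nondecreasing function $f$ on $[0,1]$ if $f(x')<f(x)<f(x'')$ for all $x',x''\in[0,1]$ with $x'<x<x''$. *)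

(* Defs.v *)
From HB Require Import structures.
From mathcomp Require Import all_boot all_order all_algebra.
From mathcomp Require Import all_classical all_reals all_analysis.
Import Order.TTheory GRing.Theory Num.Theory.
Import numFieldNormedType.Exports.

Set Implicit Arguments.
Unset Strict Implicit.
Unset Printing Implicit Defensive.

Local Open Scope classical_set_scope.
Local Open Scope ring_scope.

Definition distZ {R : realType} (t : R) : R :=
  inf [set `|t - m%:~R| | m in [set: int]].

Definition takagi {R : realType} (x : R) : R :=
  limn (series (fun n => 2 ^- n * distZ (2 ^+ n * x))).

(* Digits are indexed from 0: [b j] is the digit of weight [2 ^- j.+1]. *)
Definition binary_expansion {R : realType} (b : nat -> bool) (x : R) : Prop :=
  series (fun j => (b j)%:R * 2 ^- j.+1 : R) @ \oo --> x.

Definition deficient_digit (b : nat -> bool) (j : nat) : int :=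
  j%:Z - 2 * (\sum_(i < j) b i)%N%:Z.

Definition OmegaL {R : realType} : set R :=
  [set x | 0 <= x <= 1 /\ exists2 b : nat -> bool,
     binary_expansion b x & forall j, (1 <= j)%N -> 0 <= deficient_digit b j].

(* Meaningful on [OmegaL] only. *)
Definition tauS_OmegaL {R : realType} (x : R) : R := takagi x + x.

Definition tauS {R : realType} (x : R) : R :=
  sup [set tauS_OmegaL x1 | x1 in [set x1 | x1 <= x /\ OmegaL x1]].

(* Only the values of [f] on [0, 1] matter. *)
Definition point_of_increase {R : realType} (f : R -> R) (x : R) : Prop :=
  0 < x < 1 /\
  forall x' x'' : R, 0 <= x' <= 1 -> 0 <= x'' <= 1 -> x' < x < x'' ->
    f x' < f x < f x''.

(* The derivative is that of [f] as a function on the whole line, which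
   differs from the one on [0, 1] at most at the (null) two endpoints. *)
Definition monotone_singular {R : realType} (f : R -> R) : Prop :=
  [/\ {in `[0, 1] &, {homo f : x y / x <= y}},
      {within `[0, 1], continuous f},
      f 0 = 0,
      f 1 = 1 &
      {ae lebesgue_measure, forall x : R, x \in `[0, 1] -> is_derive x 1 f 0}].

(* Main.v *)
Require Import Defs.
From HB Require Import structures.
From mathcomp Require Import all_boot all_order all_algebra.
From mathcomp Require Import all_classical all_reals all_analysis.
From mathcomp Require Import measurable_realfun.
From mathcomp Require Import zify ring lra.
Import Order.TTheory GRing.Theory Num.Theory.
Import numFieldNormedType.Exports.

(** Reading a digit 0 as a step up and a digit 1 as a step down, [OmegaL] is the
    set of expansions whose walk, started at height 0, never goes below 0.
    Starting the walk at an arbitrary height d makes everything self-similar: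
    let W_d ([walk_set d]) be the points whose walk from d stays nonnegative,
    and F_d(x) = tau(x) + (d+1) x ([walk_fun d]), so that W_0 = [OmegaL] and
    F_0 is the function of the theorem. Removing the first digit b leads from
    W_d to W_d' with d' = d + 1 - 2b, and tau(x/2) = x/2 + tau(x)/2,
    tau((1+x)/2) = (1-x)/2 + tau(x)/2 give
      F_d(x/2) = F_(d+1)(x)/2   and   F_d((1+x)/2) = (d+2)/2 + F_(d-1)(x)/2.
    Since d+1 is harmonic for the walk killed below 0, iterating shows that F_d
    maps W_d into [0, d+1] ([walk_fun_le]). The left half of W_d is therefore
    sent into [0, (d+2)/2] and its right half above (d+2)/2, whence F_d is
    nondecreasing on W_d ([walk_fun_homo]); reading the same split backwards,
    every value in [0, d+1] is approached ([walk_fun_dense]). In other words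
    F_0 is the distribution function of the walk conditioned to stay
    nonnegative.

    The rest follows from these facts. [tauS] is nondecreasing with dense image
    in [0, 1], hence continuous with the right values at 0 and 1. The sets W_d
    are closed ([walk_set_closed]), so off [OmegaL] the function is locally
    constant, its derivative vanishes and there is no point of increase. The
    measures m_d of W_d satisfy m_d <= (m_(d+1) + m_(d-1))/2 with m_(-1) = 0
    and are bounded by 1; a bounded convex sequence cannot increase, so m_0 = 0
    ([lebesgue_measure_OmegaL]). Finally every cylinder of [OmegaL] carries two
    different values of [tauS] ([walk_fun_nonconst]), and between two points
    with different values there is always a point of increase
    ([point_of_increase_between]), so these points are dense in [OmegaL]. *)

Set Implicit Arguments.
Unset Strict Implicit.
Unset Printing Implicit Defensive.

Local Open Scope classical_set_scope.
Local Open Scope ring_scope.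

(** * Functional equation of the Takagi function *)

Section distZ.
Context {R : realType}.
Implicit Types t y : R.

Lemma distZ_lbound t : has_lbound [set `|t - m%:~R| | m in [set: int]].
Proof. by exists 0 => _ [m _ <-]. Qed.

Lemma distZ_ge0 t : 0 <= distZ t.
Proof. by apply: lb_le_inf => [|_ [m _ <-] //]; exists `|t - 0%:~R|, 0. Qed.

Lemma distZ_le1 t : distZ t <= 1.
Proof.
apply: (@le_trans _ _ `|t - (Num.floor t)%:~R|).
  by apply: ge_inf; [exact: distZ_lbound | exists (Num.floor t)].
have := floor_le_tmp t; have := floorD1_gt t; rewrite intrD => h1 h2.
by rewrite ger0_norm; lra.
Qed.

Lemma distZ_norm t : `|t| <= 2^-1 -> distZ t = `|t|.
Proof.
move=> th; apply/eqP; rewrite eq_le; apply/andP; split.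
  by apply: ge_inf; [exact: distZ_lbound | exists 0; rewrite ?subr0].
apply: lb_le_inf => [|_ [m _ <-]]; first by exists `|t - 0%:~R|, 0.
have [->|m0] := eqVneq m 0; first by rewrite subr0.
have m1 : 1 <= `|m%:~R : R| by rewrite -intr_norm ler1z -gtz0_ge1 normr_gt0.
have := ler_normB (m%:~R - t) (- t); rewrite opprK subrK normrN distrC; lra.
Qed.

Lemma distZDint t (m : int) : distZ (t + m%:~R) = distZ t.
Proof.
rewrite /distZ; congr inf; apply/seteqP; split => _ [k _ <-].
- by exists (k - m) => //; rewrite intrB; congr `|_|; ring.
- by exists (k + m) => //; rewrite intrD; congr `|_|; ring.
Qed.

Lemma distZ_half (b : bool) y : 0 <= y <= 1 ->
  distZ ((b%:R + y) / 2) = if b then (1 - y) / 2 else y / 2.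
Proof.
case: b => y01; last by rewrite add0r distZ_norm ger0_norm; lra.
have -> : (1 + y) / 2 = (y - 1) / 2 + 1%:~R by rewrite /=; lra.
by rewrite distZDint distZ_norm ler0_norm; lra.
Qed.

End distZ.

Section takagi.
Context {R : realType}.
Implicit Types x y : R.

Let term x n := 2 ^- n * distZ (2 ^+ n * x).

Let term_ge0 x n : 0 <= term x n.
Proof. by rewrite mulr_ge0 ?distZ_ge0 ?invr_ge0 ?exprn_ge0. Qed.

Let term_le x n : term x n <= geometric 1 2^-1 n.
Proof. by rewrite /= mul1r exprVn ler_piMr ?distZ_le1 ?invr_ge0 ?exprn_ge0. Qed.

Let half_lt1 : `|2^-1 : R| < 1.
Proof. by rewrite ger0_norm ?invr_ge0//; lra. Qed.

Let takagi_cvg x : cvgn (series (term x)).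
Proof.
apply: (series_le_cvg (term_ge0 x) _ (term_le x)) => [n|].
  by rewrite /= mul1r exprn_ge0 ?invr_ge0.
exact: is_cvg_geometric_series half_lt1.
Qed.

Lemma takagi_ge0 x : 0 <= takagi x.
Proof.
apply: (@limr_ge _ _ _ R 0 (series (term x))); first exact: takagi_cvg.
by apply: nearW => n; apply: sumr_ge0.
Qed.

Lemma takagi_le2 x : takagi x <= 2.
Proof.
have -> : 2 = limn (series (geometric 1 2^-1 : R^nat)).
  by apply/esym/cvg_lim => //; have := cvg_geometric_series (a := 1) half_lt1;
    rewrite (_ : 1 - 2^-1 = 2^-1) ?invrK ?mul1r//; lra.
apply: lim_series_le (term_le x); first exact: takagi_cvg.
exact: is_cvg_geometric_series half_lt1.
Qed.

(** After the first term, the series at [(b + y) / 2] is half the series at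
    [y], because [distZ] does not see the integer part [2 ^ n * b]. *)
Lemma takagi_half (b : bool) y :
  takagi ((b%:R + y) / 2) = distZ ((b%:R + y) / 2) + takagi y / 2.
Proof.
set x := (_ / 2).
have shift n : series (term x) n.+1 = distZ x + series (term y) n / 2.
  rewrite /series /= big_nat_recl// /term expr0 invr1 !mul1r; congr (_ + _).
  rewrite mulr_suml; apply: eq_bigr => i _.
  have -> : 2 ^+ i.+1 * x = 2 ^+ i * y + (2 ^ i * b)%:Z%:~R.
    by rewrite -[_%:~R]/((2 ^ i * b)%:R) /x exprS natrM natrX; field.
  rewrite distZDint exprS invfM; ring.
rewrite /takagi; apply: cvg_lim => //.
rewrite -cvg_shiftS; under eq_fun do rewrite shift.
apply: cvgD; first exact: cvg_cst.
by apply: cvgMl; exact: takagi_cvg.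
Qed.

End takagi.

(** * Walks that stay nonnegative *)

Definition walk_set {R : realType} (d : nat) : set R :=
  [set x | exists2 b : nat -> bool, binary_expansion b x &
    forall j, ((\sum_(i < j) b i).*2 <= d + j)%N].

Section walk_set.
Context {R : realType}.
Implicit Types (x y : R) (b : nat -> bool).

Let digits b : R ^nat := series (fun j => (b j)%:R * 2 ^- j.+1).

Let pow2_gt0 n : 0 < 2 ^- n :> R.
Proof. by rewrite invr_gt0 exprn_gt0. Qed.

Let digits01 b n : 0 <= digits b n <= 1 - 2 ^- n.
Proof.
elim: n => [|n IHn]; first by rewrite /digits /series /= big_geq// expr0 invr1; lra.
have -> : digits b n.+1 = digits b n + (b n)%:R * 2 ^- n.+1.
  by rewrite /digits /series /= big_nat_recr.
have -> : 2 ^- n.+1 = 2 ^- n / 2 :> R by rewrite exprS invfM mulrC.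
by have := pow2_gt0 n; case: (b n) => /=; lra.
Qed.

Let digits_shift b n :
  digits b n.+1 = ((b 0)%:R + digits (fun j => b j.+1) n) / 2.
Proof.
rewrite /digits /series /= big_nat_recl// mulrDl expr1; congr (_ + _).
rewrite mulr_suml; apply: eq_bigr => i _.
by rewrite [2 ^+ i.+2]exprS invfM; ring.
Qed.

Lemma binary_expansion01 b x : binary_expansion b x -> 0 <= x <= 1.
Proof.
move=> bx; rewrite -(cvg_lim _ bx)//; apply/andP; split.
- apply: (@limr_ge _ _ _ R 0 (digits b)); first by apply/cvg_ex; exists x.
  by apply: nearW => n; case/andP: (digits01 b n).
- apply: (@limr_le _ _ _ R 1 (digits b)); first by apply/cvg_ex; exists x.
  by apply: nearW => n; have := digits01 b n; have := pow2_gt0 n; lra.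
Qed.

Lemma walk_set01 d x : walk_set d x -> 0 <= x <= 1.
Proof. by case=> b /binary_expansion01. Qed.

Lemma OmegaLE : OmegaL = walk_set 0 :> set R.
Proof.
apply/seteqP; split => [x [_ [b bx D]]|x Wx].
  exists b => // -[|j]; first by rewrite big_ord0.
  by have := D j.+1 isT; rewrite /deficient_digit; lia.
split; first exact: walk_set01 Wx.
by case: Wx => b bx D; exists b => // j _; have := D j; rewrite /deficient_digit; lia.
Qed.

(** Together with [walk_set_fold] below, this is the self-similarity of the
    family. The equation [d' + b.*2 = d.+1] excludes a digit 1 at height 0. *)
Lemma walk_set_step d x : walk_set d x ->
  exists (b : bool) d' y, [/\ (d' + b.*2)%N = d.+1, walk_set d' y &
    x = (b%:R + y) / 2].
Proof.
case=> b bx D.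
have D1 : ((b 0).*2 <= d.+1)%N by have := D 1; rewrite big_ord1 addn1.
exists (b 0), (d.+1 - (b 0).*2)%N, (2 * x - (b 0)%:R); split; [exact: subnK| |by field].
exists (fun n => b n.+1).
  rewrite /binary_expansion; have -> : series (fun j => (b j.+1)%:R * 2 ^- j.+1 : R) =
      (fun n => 2 * digits b n.+1 - (b 0)%:R).
    by apply/funext => n; rewrite -[LHS]/(digits (fun j => b j.+1) n) digits_shift; field.
  apply: cvgB; last exact: cvg_cst.
  by apply: cvgMr; rewrite cvg_shiftS.
move=> j; have := D j.+1; rewrite big_ord_recl [nat_of_ord ord0]/=.
under eq_bigr do rewrite lift0.
by move: D1; case: (b 0); lia.
Qed.

(** The sets [walk_set d] are the largest family in [[0, 1]] with the
    self-similarity of [walk_set_step]: choosing a step again and again spells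
    out an expansion of the given point, the remainder after [n] digits being
    at most [2 ^- n]. *)
Lemma walk_set_coind (S : nat -> set R) :
  (forall d x, S d x -> 0 <= x <= 1 /\
    exists (b : bool) d' y, [/\ (d' + b.*2)%N = d.+1, S d' y &
      x = (b%:R + y) / 2]) ->
  forall d, S d `<=` walk_set d.
Proof.
move=> step d0 x0 S0.
have [next nextP] : {next : nat * R -> bool * (nat * R) & forall p, S p.1 p.2 ->
    [/\ ((next p).2.1 + (next p).1.*2)%N = p.1.+1,
        S (next p).2.1 (next p).2.2 & p.2 = ((next p).1%:R + (next p).2.2) / 2]}.
  apply: (@choice _ _ (fun (p : nat * R) (q : bool * (nat * R)) => S p.1 p.2 ->
    [/\ (q.2.1 + q.1.*2)%N = p.1.+1, S q.2.1 q.2.2 & p.2 = (q.1%:R + q.2.2) / 2])).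
  move=> [d x] /=; have [Sx|nSx] := pselect (S d x); last by exists (false, (d, x)).
  by have [_ [b [d' [y ?]]]] := step d x Sx; exists (b, (d', y)).
pose state n := iter n (fun p => (next p).2) (d0, x0).
pose b n := (next (state n)).1.
have Sn n : S (state n).1 (state n).2.
  by elim: n => //= n IHn; case: (nextP _ IHn).
have remainder n : x0 = digits b n + 2 ^- n * (state n).2.
  elim: n => [|n IHn].
    by rewrite /digits /series /= big_geq// expr0 invr1 mul1r add0r.
  rewrite {1}IHn /digits /series /= big_nat_recr//= -addrA; congr (_ + _).
  by have [_ _ ->] := nextP _ (Sn n); rewrite exprS invfM; ring.
exists b.
  apply/cvgrPdist_le => e e0.
  have := cvg_geometric (1 : R) (_ : `|2^-1 : R| < 1).
  rewrite ger0_norm ?invr_ge0// => /(_ ltac:(lra)) /cvgrPdist_le /(_ e e0).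
  apply: filterS => n; rewrite /= sub0r normrN mul1r exprVn => le_e.
  apply: le_trans le_e; rewrite [X in X - _](remainder n) addrC addKr normrM.
  apply: ler_piMr => //; have [h _] := step _ _ (Sn n).
  by rewrite ger0_norm; case/andP: h.
move=> j; suff -> : (d0 + j = (state j).1 + (\sum_(i < j) b i).*2)%N by lia.
elim: j => [|j IHj]; first by rewrite big_ord0 addn0.
have [+ _ _] := nextP _ (Sn j); rewrite -/(b j) -/(state j.+1).
by rewrite big_ord_recr/=; move: IHj; case: (b j) => /=; lia.
Qed.

Lemma walk_set_fold (b : bool) d d' y : (d' + b.*2)%N = d.+1 ->
  walk_set d' y -> walk_set d ((b%:R + y) / 2).
Proof.
move=> dd' Wy.
apply: (@walk_set_coind (fun e => walk_set e `|`
  [set x | e = d /\ x = (b%:R + y) / 2])); last by right.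
move=> e x [Wx|[-> ->]].
  split; first exact: walk_set01 Wx.
  by have [c [e' [z [? ? ?]]]] := walk_set_step Wx; exists c, e', z; split=> //; left.
split; last by exists b, d', y; split=> //; left.
by have := walk_set01 Wy; case: (b) => /=; lra.
Qed.

Lemma walk_set0 d : walk_set d (0 : R).
Proof.
apply: (@walk_set_coind (fun _ => [set 0])) => // e x ->; split; first by rewrite lexx ler01.
by exists false, e.+1, 0; split; rewrite ?addn0// add0r mul0r.
Qed.

End walk_set.

Section walk_set_closed.
Context {R : realType}.

Let closure_half (A B : set R) (b : bool) :
  (forall x, B x -> A (2 * x - b%:R)) ->
  forall x, closure B x -> closure A (2 * x - b%:R).
Proof.
move=> BA x Bx U Ux.
have : nbhs x [set z | U (2 * z - b%:R)].
  have : (fun z => 2 * z - b%:R) @ x --> 2 * x - b%:R.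
    by apply: cvgB; [apply: cvgMr; exact: cvg_id|exact: cvg_cst].
  exact.
by move=> /Bx [z [/BA Az Uz]]; exists (2 * z - b%:R).
Qed.

(** The closures inherit the self-similarity, since closure commutes with
    finite unions and with the two contractions; maximality concludes. *)
Lemma walk_set_closed d : closed (@walk_set R d).
Proof.
rewrite closure_id; apply/seteqP; split; first exact: subset_closure.
apply: (walk_set_coind (S := fun d => closure (walk_set d))) => {}d x cWx.
split.
  have : closed [set` `[0 : R, 1]] by exact: itv_closed.
  rewrite closure_id => c01; have : closure [set` `[0 : R, 1]] x.
    by apply: closureS cWx => z /walk_set01; rewrite /= in_itv.
  by rewrite -c01 /= in_itv.
pose child (b : bool) : set R := [set z | exists d' y,
  [/\ (d' + b.*2)%N = d.+1, walk_set d' y & z = (b%:R + y) / 2]].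
have : closure (child false `|` child true) x.
  apply: closureS cWx => z /walk_set_step [[] [d' [y ?]]]; [right|left];
  by exists d', y.
have key b : closure (child b) x -> exists (b : bool) d' y,
    [/\ (d' + b.*2)%N = d.+1, closure (walk_set d') y & x = (b%:R + y) / 2].
  move=> cx; have [z [[d' [y [dd' _ _]]] _]] := cx setT filterT.
  exists b, d', (2 * x - b%:R); split => //; last by field.
  apply: closure_half cx => _ [d2 [y2 [dd2 Wy ->]]].
  have -> : d' = d2 by lia.
  by rewrite (_ : _ - _ = y2)//; field.
by rewrite closureU => -[/key|/key].
Qed.

End walk_set_closed.

(** * The self-similar functions *)

Definition walk_fun {R : realType} (d : nat) (x : R) : R :=
  takagi x + d.+1%:R * x.

Lemma geometric_le {R : realType} (c r e : R) : 0 <= r < 1 -> 0 < e ->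
  exists n, c * r ^+ n <= e.
Proof.
move=> r01 e0; have := cvg_geometric c (_ : `|r| < 1).
rewrite ger0_norm; last by case/andP: r01.
case/andP: r01 => _ r1 /(_ r1) /cvgrPdist_le /(_ e e0) [n _ /(_ n (leqnn n))] /=.
by rewrite sub0r normrN => /(le_trans (ler_norm _)); exists n.
Qed.

Section walk_fun.
Context {R : realType}.
Implicit Types (x y : R) (b : bool) (d : nat).

Lemma walk_fun_half b d d' y : (d' + b.*2)%N = d.+1 -> 0 <= y <= 1 ->
  walk_fun d ((b%:R + y) / 2) = (if b then d.+2%:R / 2 else 0) + walk_fun d' y / 2.
Proof.
move=> dd' y01; rewrite /walk_fun takagi_half distZ_half//.
case: b dd' => [dd'|<-]; last by rewrite /= addn0; field.
have -> : d.+1 = d'.+2 by lia.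
by rewrite /= -![in d'.+3%:R]natr1 -![in d'.+2%:R]natr1; field.
Qed.

Lemma walk_fun0 d : walk_fun d 0 = 0 :> R.
Proof.
have /= := takagi_half false (0 : R); rewrite add0r mul0r distZ_norm ?normr0 ?invr_ge0//.
by rewrite /walk_fun mulr0 addr0; lra.
Qed.

Lemma walk_fun_ge0 d x : 0 <= x -> 0 <= walk_fun d x.
Proof. by move=> x0; rewrite addr_ge0 ?takagi_ge0// mulr_ge0. Qed.

(** Up to the error [2], the bound holds because [0 <= takagi <= 2]; each
    removed digit halves the error since [d.+1] dominates both
    [d.+2 / 2] (digit 0) and [d.+2 / 2 + d / 2] (digit 1). *)
Lemma walk_fun_le d x : walk_set d x -> walk_fun d x <= d.+1%:R.
Proof.
have bound n : forall d x, walk_set d x -> walk_fun d x <= d.+1%:R + 2 * 2^-1 ^+ n.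
  elim: n => [|n IHn] {}d {}x Wx.
    rewrite expr0 mulr1 addrC /walk_fun lerD ?takagi_le2// ler_piMr//.
    by case/andP: (walk_set01 Wx).
  have [b [d' [y [dd' Wy ->]]]] := walk_set_step Wx.
  rewrite (walk_fun_half dd') ?(walk_set01 Wy)//; have := IHn _ _ Wy.
  rewrite exprS; set u := 2^-1 ^+ n => h.
  case: b dd' h => /= dd' h.
    have -> : d.+2 = d'.+3 by lia.
    have -> : d.+1 = d'.+2 by lia.
    by move: h; rewrite -![in d'.+3%:R]natr1 -![in d'.+2%:R]natr1 -[in d'.+1%:R]natr1; lra.
  have d'E : d' = d.+1 by lia.
  move: h; rewrite d'E -![in d.+2%:R]natr1 -[in d.+1%:R]natr1.
  by have := ler0n R d; lra.
move=> Wx; apply/ler_addgt0Pr => e e0.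
have [|n ne] := @geometric_le R 2 2^-1 e _ e0; first by rewrite invr_ge0; lra.
exact: le_trans (bound n d x Wx) (lerD _ ne).
Qed.

(** At the first differing digit the two values are separated by [d.+2 / 2]:
    the smaller point has value at most half of [d.+2] by [walk_fun_le], the
    larger one at least [d.+2 / 2]. Removing a common digit doubles [y - x],
    so the common prefix is bounded in terms of [y - x]. *)
Lemma walk_fun_homo d x y : walk_set d x -> walk_set d y -> x <= y ->
  walk_fun d x <= walk_fun d y.
Proof.
move=> + + xy; have [->//|ltxy] := eqVneq x y.
have {xy ltxy} ltxy : 0 < y - x by rewrite subr_gt0 lt_neqAle ltxy.
(* The factor 2 makes the case [n = 0] impossible, as [y - x <= 1]. *)
have [|n] := @geometric_le R 2 2^-1 _ _ ltxy; first by rewrite invr_ge0; lra.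
elim: n d x y ltxy => [|n IHn] d x y.
  by move=> _; rewrite expr0 mulr1 => h /walk_set01 ? /walk_set01 ?; lra.
move=> lt_xy; rewrite exprS => le_xy.
move=> /walk_set_step [b [d1 [x' [dd1 Wx xE]]]].
move=> /walk_set_step [c [d2 [y' [dd2 Wy yE]]]].
move: lt_xy le_xy; rewrite {}xE {}yE.
have x01 := walk_set01 Wx; have y01 := walk_set01 Wy.
rewrite (walk_fun_half dd1)// (walk_fun_half dd2)//.
have Fx := walk_fun_le Wx; have Fy := @walk_fun_ge0 d2 y' ltac:(lra).
move=> lt_xy le_xy; have := @IHn d1 x' y'; move: lt_xy le_xy.
set u := 2^-1 ^+ n.
case: b c dd1 dd2 => -[] /= dd1 dd2 lt_xy le_xy IH.
- have ? : d2 = d1 by lia.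
  subst d2; have := IH ltac:(lra) ltac:(lra) Wx Wy; lra.
- by exfalso; lra.
- by rewrite (_ : d1.+1 = d.+2) in Fx; [lra|lia].
- have ? : d2 = d1 by lia.
  subst d2; have := IH ltac:(lra) ltac:(lra) Wx Wy; lra.
Qed.

(** The digits of an approximate preimage of [t] are found greedily, by
    comparing [t] with the threshold [d.+2 / 2]. *)
Lemma walk_fun_dense d (t e : R) : 0 <= t <= d.+1%:R -> 0 < e ->
  exists2 x, walk_set d x & `|walk_fun d x - t| <= e.
Proof.
move=> t01 e0.
(* The height may grow by 1 at each step, so the error is not simply halved;
   [d.+2 * (3/4)^n] decreases along every step: [(d+3)/2 <= (d+2) * 3/4]. *)
have [|n ne] := @geometric_le R d.+2%:R (3 / 4) e _ e0; first lra.
suff [x Wx h] : exists2 x, walk_set d x & `|walk_fun d x - t| <= d.+2%:R * (3 / 4) ^+ n.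
  by exists x => //; exact: le_trans h ne.
elim: n d t t01 {ne} => [|n IHn] d t t01.
  exists 0; first exact: walk_set0.
  rewrite walk_fun0 sub0r normrN expr0 mulr1 ger0_norm; last by case/andP: t01.
  by case/andP: t01 => _ /le_trans; apply; rewrite ler_nat.
rewrite exprS; have u0 : 0 <= (3 / 4) ^+ n :> R by rewrite exprn_ge0//; lra.
have [td|td] := leP t (d.+2%:R / 2).
  have [|x Wx h] := IHn d.+1 (2 * t); first lra.
  have dd' : (d.+1 + false.*2)%N = d.+1 by rewrite addn0.
  exists ((false%:R + x) / 2); first exact: walk_set_fold dd' Wx.
  rewrite (walk_fun_half dd') ?(walk_set01 Wx)// add0r.
  move: h; rewrite -[in d.+3%:R]natr1 !ler_norml -[d.+2%:R]natr1 -[d.+1%:R]natr1 => h.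
  set u := (3 / 4) ^+ n in u0 h *.
  have : 0 <= d%:R * u by rewrite mulr_ge0.
  by lra.
case: d t01 td => [|d] t01 td; first lra.
have [|x Wx h] := IHn d (2 * t - d.+3%:R).
  by move: t01 td; rewrite -[in d.+3%:R]natr1 -[in d.+2%:R]natr1; lra.
have dd' : (d + true.*2)%N = d.+2 by rewrite addn2.
exists ((true%:R + x) / 2); first exact: walk_set_fold dd' Wx.
rewrite (walk_fun_half dd') ?(walk_set01 Wx)//.
move: h; rewrite -[in d.+3%:R * _]natr1 !ler_norml -[d.+2%:R]natr1 -[d.+1%:R]natr1 => h.
set u := (3 / 4) ^+ n in u0 h *.
have : 0 <= d%:R * u by rewrite mulr_ge0.
by lra.
Qed.

(** Keep the first [n] digits of [x] and continue them in two ways; the affine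
    relation between [walk_fun d] and [walk_fun d'] preserves strict
    inequalities, so it is enough that [walk_fun d'] is not constant. *)
Lemma walk_fun_nonconst n d x : walk_set d x -> exists y z,
  [/\ walk_set d y, walk_set d z, `|y - x| <= 2^-1 ^+ n,
      `|z - x| <= 2^-1 ^+ n & walk_fun d y < walk_fun d z].
Proof.
elim: n d x => [|n IHn] d x Wx.
  have [|z Wz h] := @walk_fun_dense d 1 2^-1 _ ltac:(rewrite invr_gt0; lra).
    by rewrite ler01 ler1n.
  exists 0, z; rewrite expr0 walk_fun0; split => //; first exact: walk_set0.
  - by have := walk_set01 Wx; rewrite sub0r normrN ler_norml; lra.
  - by have := walk_set01 Wx; have := walk_set01 Wz; rewrite ler_norml; lra.
  - by move: h; rewrite ler_norml; lra.
have [b [d' [x' [dd' Wx' ->]]]] := walk_set_step Wx.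
have [y [z [Wy Wz yx zx yz]]] := IHn d' x' Wx'.
exists ((b%:R + y) / 2), ((b%:R + z) / 2).
rewrite !(walk_fun_half dd') ?(walk_set01 Wy) ?(walk_set01 Wz)//.
move: yx zx; rewrite exprS !ler_norml => yx zx.
split; [exact: walk_set_fold Wy|exact: walk_set_fold Wz| | |]; lra.
Qed.

End walk_fun.

(** * The function [tauS]: monotonicity, continuity, points of increase *)

(** A jump of a nondecreasing function would leave a gap in its image. *)
Lemma nondecreasing_dense_continuous {R : realType} (f : R -> R) (a b : R) :
  {homo f : x y / x <= y} -> (forall x, a <= f x <= b) ->
  (forall t e, a <= t <= b -> 0 < e -> exists x, `|f x - t| <= e) ->
  continuous f.
Proof.
move=> f_homo f_ab f_dense x; apply/cvgrPdist_le => e e0.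
have lo : \forall y \near x, f x - e <= f y.
  have [|h] := leP (f x - e) a.
    by move=> h; near=> y; have := f_ab y; lra.
  have [|z] := f_dense (f x - e / 2) (e / 4) _ ltac:(lra).
    by have := f_ab x; lra.
  rewrite ler_norml => zE.
  have zx : z < x by rewrite ltNge; apply/negP => /f_homo; lra.
  by near=> y; have /ltW/f_homo : z < y; [near: y; exact: lt_nbhsr|lra].
have hi : \forall y \near x, f y <= f x + e.
  have [|h] := leP b (f x + e).
    by move=> h; near=> y; have := f_ab y; lra.
  have [|z] := f_dense (f x + e / 2) (e / 4) _ ltac:(lra).
    by have := f_ab x; lra.
  rewrite ler_norml => zE.
  have xz : x < z by rewrite ltNge; apply/negP => /f_homo; lra.
  by near=> y; have /ltW/f_homo : y < z; [near: y; exact: lt_nbhsl|lra].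
by apply: filterS2 lo hi => y; rewrite ler_norml; lra.
Unshelve. all: by end_near. Qed.

Section tauS.
Context {R : realType}.
Implicit Types x y : R.

Lemma tauS_OmegaL_walk x : tauS_OmegaL x = walk_fun 0 x.
Proof. by rewrite /walk_fun mul1r. Qed.

Let below x := [set tauS_OmegaL x1 | x1 in [set x1 | x1 <= x /\ OmegaL x1]].

Let below_ubound1 x : ubound (below x) 1.
Proof.
by move=> _ [y [_ Oy] <-]; rewrite tauS_OmegaL_walk walk_fun_le// -OmegaLE.
Qed.

Let below_has_ubound x : has_ubound (below x).
Proof. by exists 1. Qed.

Let below0 x : x < 0 -> below x = set0.
Proof.
move=> x0; apply/seteqP; split => // z [y [yx Oy] _].
by move: Oy; rewrite OmegaLE => /walk_set01; lra.
Qed.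

Let below_neq0 x : 0 <= x -> below x 0.
Proof.
move=> x0; exists 0; first by rewrite OmegaLE; split=> //; exact: walk_set0.
by rewrite tauS_OmegaL_walk walk_fun0.
Qed.

Lemma tauS_ge0 x : 0 <= tauS x.
Proof.
have [x0|x0] := ltP x 0; first by rewrite /tauS -/(below x) below0// sup0.
exact: (ub_le_sup (below_has_ubound x) (below_neq0 x0)).
Qed.

Lemma tauS_le1 x : tauS x <= 1.
Proof.
have [x0|x0] := ltP x 0; first by rewrite /tauS -/(below x) below0// sup0.
by apply: (ge_sup _ (@below_ubound1 x)); exists 0; exact: (below_neq0 x0).
Qed.

Lemma tauS_homo : {homo (@tauS R) : x y / x <= y}.
Proof.
move=> x y xy; have [x0|x0] := ltP x 0.
  by rewrite {1}/tauS -/(below x) below0// sup0 tauS_ge0.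
apply: ge_sup; first by exists 0; exact: (below_neq0 x0).
move=> _ [z [zx Oz] <-]; apply: (ub_le_sup (below_has_ubound y)).
by exists z => //; split => //; exact: le_trans xy.
Qed.

Lemma tauS_walk_fun x : walk_set 0 x -> tauS x = walk_fun 0 x.
Proof.
move=> Wx; have Ox : OmegaL x by rewrite OmegaLE.
have bx : below x (walk_fun 0 x) by exists x; rewrite ?tauS_OmegaL_walk.
apply/eqP; rewrite eq_le (ub_le_sup (below_has_ubound x) bx) andbT.
apply: ge_sup; first by eexists; exact: bx.
move=> _ [y [yx +] <-]; rewrite OmegaLE tauS_OmegaL_walk => Wy.
exact: walk_fun_homo.
Qed.

(** Between [x] and [y] no new point enters the supremum. *)
Lemma tauS_gap x y : x <= y -> (forall z, x < z <= y -> ~ OmegaL z) ->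
  tauS x = tauS y.
Proof.
move=> xy gap; rewrite /tauS; congr (sup (image _ _)).
apply/seteqP; split => z [zx Oz]; split => //; first exact: le_trans xy.
by rewrite leNgt; apply/negP => xz; apply: (gap z) => //; rewrite xz.
Qed.

Lemma tauS_dense (t e : R) : 0 <= t <= 1 -> 0 < e ->
  exists x, `|tauS x - t| <= e.
Proof.
move=> t01 e0; have [x Wx xt] := @walk_fun_dense R 0 t e t01 e0.
by exists x; rewrite tauS_walk_fun.
Qed.

Lemma tauS_continuous : continuous (@tauS R).
Proof.
apply: (@nondecreasing_dense_continuous _ _ 0 1); first exact: tauS_homo.
  by move=> x; rewrite tauS_ge0 tauS_le1.
exact: tauS_dense.
Qed.

Lemma tauS0 : tauS 0 = 0 :> R.
Proof. by rewrite tauS_walk_fun ?walk_fun0//; exact: walk_set0. Qed.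

Lemma tauS1 : tauS 1 = 1 :> R.
Proof.
apply/eqP; rewrite eq_le tauS_le1/=; apply/ler_addgt0Pr => e e0.
have [x Wx xt] := @walk_fun_dense R 0 1 e ltac:(by rewrite lexx ler01) e0.
have /andP[_ /tauS_homo] := walk_set01 Wx; rewrite tauS_walk_fun//.
by move: xt; rewrite ler_norml; lra.
Qed.


Lemma tauS_near_const x : ~ OmegaL x -> \forall y \near x, tauS y = tauS x.
Proof.
move=> nOx; have : open_nbhs x (~` @OmegaL R).
  by split => //; apply: closed_openC; rewrite OmegaLE; exact: walk_set_closed.
move=> /open_nbhs_nbhs /nbhs_ballP [e /= e0 gap].
apply/nbhs_ballP; exists e => //= y; rewrite /ball /= => xy.
have [le_xy|/ltW le_yx] := leP x y; [apply/esym|]; apply: tauS_gap => // z zxy;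
  apply: gap; move: xy; rewrite /ball /= !ltr_norml; lra.
Qed.

Lemma tauS_is_derive x : ~ OmegaL x -> is_derive x 1 (@tauS R) 0.
Proof.
move=> /tauS_near_const near_x.
have : is_derive x 1 (cst (tauS x)) (0 : R) by exact: is_derive_cst.
by apply: near_eq_is_derive; near do apply/esym.
Unshelve. all: by end_near. Qed.

Lemma point_of_increase_OmegaL x : point_of_increase (@tauS R) x -> OmegaL x.
Proof.
move=> [x01 incr]; apply: contrapT => /tauS_near_const /nbhs_ballP [e /= e0 near_x].
pose y := Num.min ((1 + x) / 2) (x + e / 2).
have xy : x < y < 1 by rewrite lt_min gt_min; lra.
have := incr 0 y ltac:(lra) ltac:(lra) ltac:(lra).
rewrite (near_x y) ?ltxx ?andbF//; rewrite /ball /= ltr_norml.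
have : y <= x + e / 2 by rewrite ge_min lexx orbT.
by lra.
Qed.

(** A value [v] between [tauS y] and [tauS z] that is not taken at a rational
    exists because the rationals are countable; a point where [v] is taken is a
    point of increase, since otherwise [tauS] would be equal to [v] on a whole
    interval, which contains a rational. *)
Lemma point_of_increase_between y z : 0 <= y -> z <= 1 -> tauS y < tauS z ->
  exists2 x, y <= x <= z & point_of_increase (@tauS R) x.
Proof.
move=> y0 z1 lt_yz.
have lt01 : y < z by rewrite ltNge; apply/negP => /tauS_homo; lra.
have [v [v_yz vQ]] : exists v, tauS y < v < tauS z /\
    forall q : rat, tauS (ratr q) <> v.
  apply: contrapT => /forallNP nv.
  have : `]tauS y, tauS z[ `<=` range (@tauS R \o ratr).
    move=> v /=; rewrite in_itv /= => v_yz.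
    have := nv v => /not_andP [//|/existsNP [q /contrapT qv]].
    by exists q.
  move=> sub; have : countable (range (@tauS R \o ratr)).
    exact: sub_countable (card_image_le _ _) (countableP [set: rat]).
  move=> /(sub_countable (subset_card_le sub)) /countable_lebesgue_measure0.
  rewrite lebesgue_measure_itv/= lte_fin lt_yz -EFinB => /eqP.
  by rewrite eqe subr_eq0 => /eqP; lra.
have [||x] := @IVT R (@tauS R) y z v (ltW lt01).
- by apply: continuous_subspaceT; exact: tauS_continuous.
- by rewrite min_l ?max_r ?ltW//; lra.
rewrite in_itv/= => xyz xv; exists x => //.
have {}xyz : y < x < z.
  by rewrite !lt_neqAle; apply/andP; split; apply/andP; split;
    try (by case/andP: xyz); apply/eqP => xE; move: v_yz; rewrite -xv xE ltxx// andbF.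
split; first lra.
move=> x' x'' _ _ /andP[x'x xx''].
have strict u w : u < w -> (u = x \/ w = x) -> tauS u < tauS w.
  move=> uw xuw; rewrite lt_neqAle tauS_homo ?ltW// andbT; apply/eqP => uwE.
  have [q] := rat_in_itvoo uw; rewrite in_itv/= => /andP[/ltW/tauS_homo uq /ltW/tauS_homo qw].
  by apply: (vQ q); case: xuw => xE; subst; lra.
by rewrite !strict//; [left|right].
Qed.

Lemma closure_point_of_increase :
  closure [set x : R | point_of_increase (@tauS R) x] = @OmegaL R.
Proof.
rewrite OmegaLE; apply/seteqP; split.
  have := @walk_set_closed R 0; rewrite closure_id => ->.
  by apply: closureS => x /point_of_increase_OmegaL; rewrite OmegaLE.
move=> x Wx U /nbhs_ballP [e /= e0 eU].
have [|n] := @geometric_le R 2 2^-1 e _ e0; first by rewrite invr_ge0; lra.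
have [y [z [Wy Wz yx zx]]] := walk_fun_nonconst n Wx.
rewrite -!tauS_walk_fun// => yz.
have := walk_set01 Wy; have := walk_set01 Wz => z01 y01.
move: yx zx; set u := 2^-1 ^+ n; rewrite !ler_norml => yx zx ue.
have [|//|t tyz tP] := @point_of_increase_between y z _ _ yz; [lra|lra|].
exists t; split => //; apply: eU; rewrite /ball /= ltr_norml; lra.
Qed.

End tauS.

(** * The deficient digit set is negligible *)

(** With [m (-1) = 0] the hypotheses say that [m] is convex, so its increments
    are at least the first one, [m 0], and [m] grows at least linearly with
    slope [m 0]. *)
Lemma convex_bounded_eq0 {R : realType} (m : nat -> R) :
  (forall d, 0 <= m d <= 1) -> m 0 <= m 1 / 2 ->
  (forall d, m d.+1 <= (m d + m d.+2) / 2) -> m 0 = 0.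
Proof.
move=> m01 m_0 m_convex.
have slope d : m 0 <= m d.+1 - m d.
  by elim: d => [|d IHd]; [lra|have := m_convex d; lra].
have m_ge d : d.+1%:R * m 0 <= m d.
  elim: d => [|d IHd]; first by rewrite mul1r.
  by have := slope d; rewrite -natr1 mulrDl mul1r; lra.
apply/eqP; rewrite eq_le; have /andP[-> _] := m01 0; rewrite andbT leNgt.
apply/negP => m0.
have := m_ge (Num.truncn (m 0)^-1); have := m01 (Num.truncn (m 0)^-1).
have := truncnS_gt (m 0)^-1; rewrite -(ltr_pM2r m0) mulVf ?gt_eqF//; lra.
Qed.

Section measure.
Context {R : realType}.

Let affine_measurable (a c : R) : measurable_fun setT (fun z : R => a * z + c).
Proof. apply: continuous_measurable_fun => z.
apply: cvgD; [apply: cvgMr; exact: cvg_id|exact: cvg_cst]. Qed.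

(** Both sides define measures in [A], once multiplied by [a], which agree on
    half-open intervals. *)
Lemma lebesgue_measure_affine_preimage (a c : R) (A : set R) :
  0 < a -> measurable A ->
  lebesgue_measure ((fun z => a * z + c) @^-1` A) =
    ((a^-1)%:E * lebesgue_measure A)%E.
Proof.
move=> a0 mA; pose h := fun z : R => a * z + c.
pose an : {nonneg R} := NngNum (ltW a0).
have mh : measurable_fun setT (h : measurableTypeR R -> measurableTypeR R).
  exact: affine_measurable.
have itv_eq X : ocitv X ->
    lebesgue_measure X = (a%:E * lebesgue_measure (h @^-1` X))%E.
  move=> [[u v] _ <-].
  have -> : h @^-1` `]u, v]%classic = `](u - c) / a, (v - c) / a]%classic.
    apply/seteqP; split=> z /=; rewrite !in_itv/= /h ler_pdivlMr// ltr_pdivrMr//;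
    rewrite (mulrC z); lra.
  rewrite !lebesgue_measure_itv/= !lte_fin ltr_pM2r ?invr_gt0// ltrD2r.
  case: ltP => _; last by rewrite mule0.
  by rewrite -!EFinB -EFinM; congr EFin; field; rewrite gt_eqF.
have -> : lebesgue_measure A = (a%:E * lebesgue_measure (h @^-1` A))%E.
  unshelve refine (@lebesgue_measure_unique R (mscale an
    (pushforward (@lebesgue_measure R)
      (h : measurableTypeR R -> measurableTypeR R)) :
    {measure set (measurableTypeR R) -> \bar R}) _ A _).
  - exact: mh.
  - exact: itv_eq.
  - exact: mA.
by rewrite muleA -EFinM mulVf ?gt_eqF// mul1e.
Qed.

Lemma walk_set_measurable d : measurable (@walk_set R d).
Proof. by apply: closed_measurable; exact: walk_set_closed. Qed.

Lemma lebesgue_measure_walk_set_le1 d : (lebesgue_measure (@walk_set R d) <= 1)%E.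
Proof.
have -> : 1%E = lebesgue_measure [set` `[0 : R, 1]].
  by rewrite lebesgue_measure_itv/= lte_fin ltr01 oppr0 adde0.
apply: le_measure; rewrite ?inE//; first exact: walk_set_measurable.
by move=> x /walk_set01; rewrite /= in_itv.
Qed.

Let child (b : bool) d : set R := (fun x : R => 2 * x - b%:R) @^-1` walk_set d.

Let child_measurable b d : measurable (child b d).
Proof.
rewrite -[child b d]setTI.
by apply: affine_measurable => //; exact: walk_set_measurable.
Qed.

Let m d := fine (lebesgue_measure (@walk_set R d)).

Let mE d : lebesgue_measure (@walk_set R d) = (m d)%:E.
Proof.
rewrite fineK// ge0_fin_numE//.
exact: le_lt_trans (lebesgue_measure_walk_set_le1 d) (ltry _).
Qed.

Let child_measure b d : lebesgue_measure (child b d) = (m d / 2)%:E.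
Proof.
rewrite lebesgue_measure_affine_preimage// ?mE -?EFinM ?[m d / 2]mulrC//.
exact: walk_set_measurable.
Qed.

Let walk_set_child d (x : R) : walk_set d x ->
  exists (b : bool) d', (d' + b.*2)%N = d.+1 /\ child b d' x.
Proof.
move=> /walk_set_step [b [d' [y [dd' Wy ->]]]]; exists b, d'; split => //.
by rewrite /child /= (_ : _ - _ = y)//; field.
Qed.

(** The chance that a symmetric walk from height [d] stays nonnegative is at
    most the mean of the chances from its two neighbours, the one from height
    -1 being 0. *)
Lemma lebesgue_measure_OmegaL : lebesgue_measure (@OmegaL R) = 0%E.
Proof.
rewrite OmegaLE mE; congr EFin; apply: convex_bounded_eq0 => [d||d].
- have := lebesgue_measure_walk_set_le1 d; rewrite mE lee_fin => ->.
  by rewrite fine_ge0.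
- rewrite -lee_fin -mE -(child_measure false).
  apply: le_measure; rewrite ?inE//.
  - exact: walk_set_measurable.
  - exact: child_measurable.
  move=> x /walk_set_child [b [d' []]].
  case: b => /= dd'; first by exfalso; lia.
  by have -> : d' = 1 by lia.
- rewrite -lee_fin -mE addrC mulrDl EFinD -(child_measure false) -(child_measure true).
  have := measureU2 lebesgue_measure
    (child_measurable false d.+2) (child_measurable true d).
  apply: le_trans.
  apply: le_measure; rewrite ?inE//.
  - exact: walk_set_measurable.
  - by apply: measurableU; exact: child_measurable.
  move=> x /walk_set_child [[] [d' [/= dd' dx]]].
    by right; rewrite (_ : d = d')//; lia.
  by left; rewrite (_ : d.+2 = d')//; lia.
Qed.

End measure.

(** * Conclusion *)

Theorem theorem1p5 (R : realType) :
  [/\ {in @OmegaL R &, {homo @tauS_OmegaL R : x y / x <= y}},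
      {in @OmegaL R, @tauS R =1 @tauS_OmegaL R},
      monotone_singular (@tauS R) &
      closure [set x : R | point_of_increase (@tauS R) x] = @OmegaL R].
Proof.
split.
- move=> x y; rewrite !inE OmegaLE !tauS_OmegaL_walk; exact: walk_fun_homo.
- by move=> x; rewrite inE OmegaLE tauS_OmegaL_walk; exact: tauS_walk_fun.
- split.
  + by move=> x y _ _; exact: tauS_homo.
  + by apply: continuous_subspaceT; exact: tauS_continuous.
  + exact: tauS0.
  + exact: tauS1.
  + exists (@OmegaL R); split; [|exact: lebesgue_measure_OmegaL|].
      by rewrite OmegaLE; exact: walk_set_measurable.
    by move=> x /= nder; apply: contrapT => nOx; apply: nder => _; exact: tauS_is_derive.
- exact: closure_point_of_increase.
Qed.
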